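(* Let $Q = (\mathcal{I}, E)$ be a quiver and $\mathbf{v} \in \mathbb{Z}^{\mathcal{I}}_{\geq 0}$ a dimension vector. Let $\alpha \in Z(\mathfrak{g})$ be a central parameter such that $(\overline{Q}, \mathbf{v}, \alpha)$ is $2$-filtered. Let $f = \|\Phi_{\mathbb{R}} - \alpha\|^{2}$ be the norm-square of the real moment map on $T^{*}\mathrm{Rep}(Q, \mathbf{v}) = \mathrm{Rep}(\overline{Q}, \mathbf{v})$, and let $(A, B) \in \mathrm{Crit}(f) \cap \Phi_{\mathbb{C}}^{-1}(0)_{\mathbf{v}^*} \subseteq T^{*}\mathrm{Rep}(Q, \mathbf{v})$, where $\mathbf{v}^*$ is a Harder-Narasimhan type. Then locally near $(A, B)$, $$\Phi_{\mathbb{C}}^{-1}(0) \cap \pi_{\mathbf{v}^*}^{-1}(A, B) = \ker (d\Phi_{\mathbb{C}})_{(A,B)} \cap \pi_{\mathbf{v}^*}^{-1}(A, B),$$ where both $\pi_{\mathbf{v}^*}^{-1}(A,B)$ and $\ker (d\Phi_{\mathbb{C}})_{(A,B)}$ are considered as affine subspaces of $T^{*}\mathrm{Rep}(Q, \mathbf{v})$ going through $(A,B)$.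
   Context: A quiver $Q=(\mathcal{I},E)$ is a finite oriented graph; $\mathrm{out}(a),\mathrm{in}(a)$ are the tail and head of $a\in E$. $V_\ell$ are hermitian vector spaces with $\dim_{\mathbb{C}}V_\ell=v_\ell$; $\mathrm{Rep}(Q,\mathbf{v})=\bigoplus_{a\in E}\mathrm{Hom}(V_{\mathrm{out}(a)},V_{\mathrm{in}(a)})$. $T^*\mathrm{Rep}(Q,\mathbf{v})\cong\bigoplus_{a\in E}\left(\mathrm{Hom}(V_{\mathrm{out}(a)},V_{\mathrm{in}(a)})\oplus\mathrm{Hom}(V_{\mathrm{in}(a)},V_{\mathrm{out}(a)})\right)\ni(A,B)$ is identified with $\mathrm{Rep}(\overline{Q},\mathbf{v})$, where $\overline{Q}$ is $Q$ with an extra reversed arrow added for each $a\in E$; it carries the standard hermitian structure. $G=\prod_\ell U(V_\ell)$ and $G_{\mathbb{C}}=\prod_\ell GL(V_\ell)$ act by conjugation; $\mathfrak{g}=\prod_\ell\mathfrak{u}(V_\ell)$ has inner product $\mathrm{tr}(u^*v)$. The real moment map is $\Phi_{\mathbb{R}}(C)=\frac{i}{2}\sum_{a\in\overline{E}}[C_a,C_a^*]\in\mathfrak{g}$ for $C\in\mathrm{Rep}(\overline{Q},\mathbf{v})$. The holomorphic moment map $\Phi_{\mathbb{C}}:T^*\mathrm{Rep}(Q,\mathbf{v})\to\mathfrak{g}_{\mathbb{C}}=\prod_\ell\mathfrak{gl}(V_\ell)$ is $\Phi_{\mathbb{C}}(A,B)_\ell=\sum_{a:\mathrm{in}(a)=\ell}A_aB_a-\sum_{a':\mathrm{out}(a')=\ell}B_{a'}A_{a'}$.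 A central parameter is $\alpha=(\alpha_\ell)\in(i\mathbb{R})^{\mathcal{I}}$, identified with $(\alpha_\ell\,\mathrm{id}_{V_\ell})_\ell\in Z(\mathfrak{g})$, with $\sum_\ell\alpha_\ell v_\ell=0$. The slope of a nonzero dimension vector $\mathbf{w}$ is $\mu_\alpha(\mathbf{w})=\left(\sum_\ell i\alpha_\ell w_\ell\right)/\left(\sum_\ell w_\ell\right)$. A subrepresentation of a representation $C$ is a collection of subspaces preserved by all $C_a$, with restricted maps. The Harder-Narasimhan filtration of $C$ is $0=C_0\subsetneq C_1\subsetneq\cdots\subsetneq C_L=C$ where each $C_j/C_{j-1}$ is the nonzero subrepresentation of $C/C_{j-1}$ of maximal slope and, among those, maximal rank (total dimension); $L$ is its length and $\mathbf{v}^*=(\mathbf{v}_1,\dots,\mathbf{v}_L)$, with $\mathbf{v}_j$ the dimension vector of $C_j/C_{j-1}$, its type. $(\overline{Q},\mathbf{v},\alpha)$ is $2$-filtered if every $C\in\mathrm{Rep}(\overline{Q},\mathbf{v})$ has Harder-Narasimhan filtration of length at most $2$. $S_{\mathbf{v}^*}\subseteq\mathrm{Rep}(\overline{Q},\mathbf{v})$ is the set of representations of type $\mathbf{v}^*$ (a locally closed submanifold), and $\Phi_{\mathbb{C}}^{-1}(0)_{\mathbf{v}^*}=\Phi_{\mathbb{C}}^{-1}(0)\cap S_{\mathbf{v}^*}$. $\pi_{\mathbf{v}^*}:U_{\mathbf{v}^*}\to S_{\mathbf{v}^*}$ is the orthogonal projection of a tubular neighbourhood $U_{\mathbf{v}^*}$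 of $S_{\mathbf{v}^*}$ in $\mathrm{Rep}(\overline{Q},\mathbf{v})$ (identified with a disk bundle of the normal bundle of $S_{\mathbf{v}^*}$), so that near $(A,B)$ the fibre $\pi_{\mathbf{v}^*}^{-1}(A,B)$ is the affine subspace through $(A,B)$ in the directions orthogonal to $T_{(A,B)}S_{\mathbf{v}^*}$. *)

(* Defs.v *)
From HB Require Import structures.
From mathcomp Require Import all_boot all_order all_algebra.
From mathcomp Require Import all_classical all_reals all_analysis.
From mathcomp Require Import complex.

Set Implicit Arguments.
Unset Strict Implicit.
Unset Printing Implicit Defensive.

Import Order.TTheory GRing.Theory Num.Theory.
Import numFieldNormedType.Exports.

Local Open Scope classical_set_scope.
Local Open Scope ring_scope.
Local Open Scope sesquilinear_scope.

Record quiver (I : finType) := Quiver {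
  arrow : finType;
  qtail : arrow -> I;
  qhead : arrow -> I }.
Arguments qtail {I q} a.
Arguments qhead {I q} a.

(* [inl a] is the arrow a itself, [inr a] the added reversed arrow. *)
Definition double_quiver (I : finType) (Q : quiver I) : quiver I :=
  @Quiver I (arrow Q + arrow Q)%type
    (fun e => match e with inl a => qtail a | inr a => qhead a end)
    (fun e => match e with inl a => qhead a | inr a => qtail a end).

(* V_l is C^(v l), as column vectors, with its standard hermitian form; a
   matrix acts by left multiplication, so Hom(V_k, V_l) is 'M_(v l, v k). *)
Definition rep (R : realType) (I : finType) (Q : quiver I) (v : I -> nat) :=
  forall a : arrow Q, 'M[R[i]]_(v (qhead a), v (qtail a)).

Definition gl (R : realType) (I : finType) (v : I -> nat) :=
  forall l : I, 'M[R[i]]_(v l).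

(* An endomorphism of V_k seen as an endomorphism of V_l; it is only used for
   k = l, where [conform_mx] is a mere cast. *)
Definition gl_cast (R : realType) (I : finType) (v : I -> nat) (k l : I)
    (M : 'M[R[i]]_(v k)) : 'M[R[i]]_(v l) :=
  conform_mx 0 M.

Section Quiver.
Variables (R : realType) (I : finType) (Q : quiver I) (v : I -> nat).
Implicit Types (C D X : rep R Q v) (alpha : I -> R[i]) (w : I -> nat).

Definition rep_line C X (t : R) : rep R Q v := fun a => C a + t%:C%C *: X a.

Definition rep_sub C D : rep R Q v := fun a => C a - D a.

(* Riemannian metric: the real part of the standard hermitian form. *)
Definition rep_dot C D : R := complex.Re (\sum_a \tr (C a *m (D a)^t*)).

Definition rep_dist C D : R :=
  Num.sqrt (rep_dot (rep_sub D C) (rep_sub D C)).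

Definition rep_ball C (e : R) : set (rep R Q v) := [set D | rep_dist C D < e].

(* [C_a, C_a^*] has component C_a C_a^* at the head of a and - C_a^* C_a at
   its tail. *)
Definition real_moment C : gl R v := fun l =>
  ('i%C / 2%:R) *:
    (\sum_(a : arrow Q | qhead a == l) gl_cast l (C a *m (C a)^t*)
     - \sum_(a : arrow Q | qtail a == l) gl_cast l ((C a)^t* *m C a)).

Definition gl_normsq (u : gl R v) : R :=
  complex.Re (\sum_l \tr ((u l)^t* *m u l)).

Definition moment_normsq alpha C : R :=
  gl_normsq (fun l => real_moment C l - (alpha l)%:M).

(* Both functions differentiated below are polynomial in the real and
   imaginary parts of the entries, so their differential at C in the direction
   X is the derivative at 0 along the line C + t X. *)
Definition critical (f : rep R Q v -> R) C : Prop :=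
  forall X, is_derive (0 : R) 1 (fun t : R => f (rep_line C X t)) 0.

Definition is_cderive (g : R -> R[i]) (t : R) (d : R[i]) : Prop :=
  is_derive t 1 (fun s => complex.Re (g s)) (complex.Re d) /\
  is_derive t 1 (fun s => complex.Im (g s)) (complex.Im d).

Definition differential_kernel (F : rep R Q v -> gl R v) C :
    set (rep R Q v) :=
  [set X | forall l i j, is_cderive (fun t => F (rep_line C X t) l i j) 0 0].

Definition smooth (g : R -> R) : Prop :=
  forall n t, derivable (derive1n n g) t 1.

Definition smooth_curve (c : R -> rep R Q v) : Prop :=
  forall a i j, smooth (fun t => complex.Re (c t a i j)) /\
                smooth (fun t => complex.Im (c t a i j)).

(* Velocities at C of the smooth curves lying in S; this is the tangent space
   when S is an embedded submanifold. *)
Definition tangent (S : set (rep R Q v)) C : set (rep R Q v) :=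
  [set X | exists c : R -> rep R Q v,
     [/\ smooth_curve c, c 0 = C, \forall t \near (0 : R), S (c t) &
         forall a i j, is_cderive (fun t => c t a i j) 0 (X a i j)]].

(* The fibre over C of the orthogonal projection of a tubular neighbourhood of
   S, extended to the whole affine subspace normal to S at C. *)
Definition normal_fibre (S : set (rep R Q v)) C : set (rep R Q v) :=
  [set D | forall X, tangent S C X -> rep_dot (rep_sub D C) X = 0].

Definition subspaces := forall l : I, {vspace 'cV[R[i]]_(v l)}.
Implicit Types (U W : subspaces).

Definition subrep C W : Prop :=
  forall (a : arrow Q) x, x \in W (qtail a) -> C a *m x \in W (qhead a).

Definition subspaces_le U W : Prop := forall l, (U l <= W l)%VS.

Definition quot_dim U W : I -> nat := fun l => (\dim (W l) - \dim (U l))%N.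

Definition total_dim w : nat := (\sum_l w l)%N.

Definition slope alpha w : R :=
  complex.Re (\sum_l 'i%C * alpha l * (w l)%:R) / (total_dim w)%:R.

(* The subrepresentations of C / U are the W / U with W a subrepresentation
   of C containing U. *)
Definition quot_subrep C U W : Prop :=
  [/\ subrep C W, subspaces_le U W & (0 < total_dim (quot_dim U W))%N].

Definition HN_step alpha C U W : Prop :=
  quot_subrep C U W /\
  forall W', quot_subrep C U W' ->
    slope alpha (quot_dim U W') <= slope alpha (quot_dim U W) /\
    (slope alpha (quot_dim U W') = slope alpha (quot_dim U W) ->
     (total_dim (quot_dim U W') <= total_dim (quot_dim U W))%N).

Definition HN_filtration alpha C (L : nat) (F : nat -> subspaces) : Prop :=
  [/\ forall l, F 0%N l = 0%VS, forall l, F L l = fullv &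
      forall j, (j < L)%N -> HN_step alpha C (F j) (F j.+1)].

Definition HN_stratum alpha (vs : seq (I -> nat)) : set (rep R Q v) :=
  [set C | exists F, HN_filtration alpha C (size vs) F /\
     forall j l, (j < size vs)%N ->
       nth (fun=> 0%N) vs j l = quot_dim (F j) (F j.+1) l].

Definition two_filtered alpha : Prop :=
  forall C L F, HN_filtration alpha C L F -> (L <= 2)%N.

End Quiver.

Arguments two_filtered {R I} Q v alpha.
Arguments HN_stratum {R I} Q v alpha vs.

Section Cotangent.
Variables (R : realType) (I : finType) (Q : quiver I) (v : I -> nat).
Implicit Types (C D : rep R (double_quiver Q) v).

Definition partA C (a : arrow Q) : 'M[R[i]]_(v (qhead a), v (qtail a)) :=
  C (inl a).

Definition partB C (a : arrow Q) : 'M[R[i]]_(v (qtail a), v (qhead a)) :=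
  C (inr a).

Definition hol_moment C : gl R v := fun l =>
  \sum_(a : arrow Q | qhead a == l) gl_cast l (partA C a *m partB C a)
  - \sum_(a : arrow Q | qtail a == l) gl_cast l (partB C a *m partA C a).

Definition hol_moment_zero : set (rep R (double_quiver Q) v) :=
  [set C | forall l, hol_moment C l = 0].

(* ker d(Phi_C) at C, as an affine subspace through C. *)
Definition affine_kernel C : set (rep R (double_quiver Q) v) :=
  [set D | differential_kernel hol_moment C (rep_sub D C)].

End Cotangent.
Arguments hol_moment_zero {R I} Q v.

(* Main.v *)
From HB Require Import structures.
Require Import Defs.
From mathcomp Require Import all_boot all_order all_algebra.
From mathcomp Require Import all_classical all_reals all_analysis.
From mathcomp Require Import complex ring lra.

Set Implicit Arguments.
Unset Strict Implicit.
Unset Printing Implicit Defensive.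

Import Order.TTheory GRing.Theory Num.Theory.
Import numFieldNormedType.Exports.
Local Open Scope classical_set_scope.
Local Open Scope ring_scope.
Local Open Scope sesquilinear_scope.

(** Write [h] for [-i (Phi_R(C) - alpha)], a hermitian endomorphism of each
    [V_l], and consider a point [C + X]. Since the holomorphic moment map is
    quadratic, [Phi_C(C + X) = Phi_C(C) + dPhi_C(X) + Phi_C(X)], so the
    theorem says that [Phi_C(X) = 0] whenever [X] is normal to the stratum of
    [C]; the equality of the two sets then holds in a ball of any radius. The
    term [Phi_C(X)] vanishes because a normal vector is nilpotent: with [U] the
    first step of the Harder-Narasimhan filtration, it maps [V] into the
    orthogonal complement of [U] and kills that complement, so that the
    composite of two of its components is zero ([hol_moment_two_step]). This is
    where a filtration of length at most two is essential.

    That normal vectors have this shape follows by testing them against the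
    vectors [Y] that preserve the filtration ([orthogonal_to_preserving]),
    provided that these are tangent to the stratum ([tangent_stratum]), that is,
    provided that the filtration of [C] remains the Harder-Narasimhan filtration
    of [C + t Y] for small [t] ([HN_filtration_line]). This openness statement
    is obtained without compactness of Grassmannians, from the real moment map.

    - Criticality means that [h] commutes with [C]
      ([critical_hmoment_commute]), so that sums of eigenspaces of [h] are
      subrepresentations.
    - For a subrepresentation [W] of any representation [D], with orthogonal
      projector [P], the degree [sum_l i alpha_l dim W_l] is at most the trace
      of [P h_D], with equality if [P] commutes with [D] ([degree_le],
      [degree_eq]). In an eigenbasis of [h] this trace is a sum of eigenvalues
      weighted by numbers in [0, 1] whose total is the rank of [W].
    - Hence each step of the filtration of [C] adds the eigenspace of the
      greatest remaining eigenvalue, which is the slope of that step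
      ([HN_step_spectral]).
    - For [D = C + t Y] the endomorphisms [h_D] and [h] are close, so the same
      slope inequalities hold up to a small error that does not depend on [W]
      ([degree_line_le]). As degrees and ranks range over a finite set, a small
      error is no error ([HN_step_line]). *)

(** * Adjoints and orthogonal projectors *)

Section Projectors.
Context {C : numClosedFieldType}.

Lemma adjmxM m n p (A : 'M[C]_(m, n)) (B : 'M[C]_(n, p)) :
  (A *m B)^t* = B^t* *m A^t*.
Proof. by rewrite trmx_mul map_mxM. Qed.

Lemma adjmxB m n (A B : 'M[C]_(m, n)) : (A - B)^t* = A^t* - B^t*.
Proof. by rewrite linearB /= map_mxB. Qed.

Lemma adjmxD m n (A B : 'M[C]_(m, n)) : (A + B)^t* = A^t* + B^t*.
Proof. by rewrite linearD /= map_mxD. Qed.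

Lemma adjmxZ m n (c : C) (A : 'M[C]_(m, n)) : (c *: A)^t* = c^* *: A^t*.
Proof. by rewrite linearZ /= map_mxZ. Qed.

Lemma adjmx_scalar n (c : C) : (c%:M : 'M[C]_n)^t* = (c^*)%:M.
Proof. by rewrite tr_scalar_mx map_scalar_mx. Qed.

Lemma adjmx1 n : (1%:M : 'M[C]_n)^t* = 1%:M.
Proof. by rewrite adjmx_scalar rmorph1. Qed.

Lemma mxtrace_adj n (A : 'M[C]_n) : \tr (A^t*) = (\tr A)^*.
Proof. by rewrite trace_map_mx mxtrace_tr. Qed.

Lemma mxtrace_mul_adj m n (A : 'M[C]_(m, n)) :
  \tr (A *m A^t*) = \sum_i \sum_j `|A i j| ^+ 2.
Proof.
apply: eq_bigr => i _; rewrite mxE; apply: eq_bigr => j _.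
by rewrite !mxE normCK.
Qed.

Lemma mxtrace_mul_adj_ge0 m n (A : 'M[C]_(m, n)) : 0 <= \tr (A *m A^t*).
Proof.
by rewrite mxtrace_mul_adj; do 2!apply: sumr_ge0 => ? _; rewrite exprn_ge0.
Qed.

Lemma mxtrace_mul_adj_eq0 m n (A : 'M[C]_(m, n)) :
  \tr (A *m A^t*) = 0 -> A = 0.
Proof.
rewrite mxtrace_mul_adj => /eqP; rewrite psumr_eq0; last first.
  by move=> i _; apply: sumr_ge0 => j _; rewrite exprn_ge0.
move=> /allP A0; apply/matrixP => i j; rewrite mxE.
have /A0/= := mem_index_enum i; rewrite psumr_eq0; last first.
  by move=> k _; rewrite exprn_ge0.
move=> /allP/(_ _ (mem_index_enum j))/=.
by rewrite sqrf_eq0 normr_eq0 => /eqP.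
Qed.

Definition projector n (P : 'M[C]_n) := P^t* = P /\ P *m P = P.

Lemma projectorC n (P : 'M[C]_n) : projector P -> projector (1%:M - P).
Proof.
case=> Ph Pi; split; first by rewrite adjmxB adjmx1 Ph.
by rewrite mulmxBl mul1mx mulmxBr mulmx1 Pi subrr subr0.
Qed.

Lemma mxtrace_sandwich m n (P : 'M[C]_n) (A : 'M[C]_(m, n)) : projector P ->
  \tr (A *m P *m A^t*) = \tr ((A *m P) *m (A *m P)^t*).
Proof.
by case=> Ph Pi; rewrite adjmxM Ph mulmxA -(mulmxA A P P) Pi.
Qed.

Lemma mxtrace_sandwich_ge0 m n (P : 'M[C]_n) (A : 'M[C]_(m, n)) :
  projector P -> 0 <= \tr (A *m P *m A^t*).
Proof. by move=> pP; rewrite mxtrace_sandwich // mxtrace_mul_adj_ge0. Qed.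

Lemma mxtrace_sandwich_le m n (P : 'M[C]_n) (A : 'M[C]_(m, n)) :
  projector P -> \tr (A *m P *m A^t*) <= \tr (A *m A^t*).
Proof.
move=> pP; rewrite -subr_ge0 -raddfB /= -mulmxBl -{1}[A]mulmx1 -mulmxBr.
exact/mxtrace_sandwich_ge0/projectorC.
Qed.

Lemma mxtrace_sandwich_eq0 m n (P : 'M[C]_n) (A : 'M[C]_(m, n)) :
  projector P -> \tr (A *m P *m A^t*) = 0 -> A *m P = 0.
Proof. by move=> pP; rewrite mxtrace_sandwich // => /mxtrace_mul_adj_eq0. Qed.

End Projectors.

Definition vbasis_mx (K : fieldType) n (W : {vspace 'cV[K]_n}) :
  'M[K]_(n, \dim W) := \matrix_(i, j) (vbasis W)`_j i 0.

(** The orthogonal projector onto [W]; the inverse of the Gram matrix corrects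
    for the failure of the basis to be orthonormal. *)
HB.lock Definition oproj (C : numClosedFieldType) n (W : {vspace 'cV[C]_n}) :
    'M[C]_n :=
  vbasis_mx W *m invmx ((vbasis_mx W)^t* *m vbasis_mx W) *m (vbasis_mx W)^t*.

Arguments oproj {C n} W.

Section OrthogonalProjections.
Context {C : numClosedFieldType}.

Section OneSubspace.
Variables (n : nat) (W : {vspace 'cV[C]_n}).

Let B : 'M[C]_(n, \dim W) := vbasis_mx W.

Let mulBE (y : 'cV_(\dim W)) : B *m y = \sum_j y j 0 *: (vbasis W)`_j.
Proof.
apply/colP => i; rewrite mxE summxE; apply: eq_bigr => j _.
by rewrite !mxE mulrC.
Qed.

Let memB x : x \in W -> exists y, x = B *m y.
Proof.
move=> xW; exists (\col_j coord (vbasis W) j x); rewrite mulBE.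
by rewrite {1}(coord_vbasis xW); apply: eq_bigr => j _; rewrite mxE.
Qed.

Let mulB_mem y : B *m y \in W.
Proof.
rewrite mulBE; apply: memv_suml => j _; rewrite memvZ // vbasis_mem //.
by rewrite mem_nth // size_tuple.
Qed.

(* A vector in the kernel of [B^* B] lies in that of [B], since
   [|B y|^2 = y^* B^* B y]. *)
Let gram_unit : B^t* *m B \in unitmx.
Proof.
rewrite -unitmx_tr -row_free_unit; apply: inj_row_free => u u0.
suff /(congr1 trmx) : u^T = 0 by rewrite trmxK trmx0.
have G0 : B^t* *m (B *m u^T) = 0.
  by apply: trmx_inj; rewrite mulmxA trmx_mul trmxK u0 trmx0.
have Bu0 : B *m u^T = 0.
  suff : (B *m u^T)^t* = 0.
    by move=> /(congr1 (fun M => M^t*)); rewrite trmxCK trmx0 map_mx0.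
  apply: mxtrace_mul_adj_eq0; rewrite trmxCK adjmxM -mulmxA G0 mulmx0.
  exact: mxtrace0.
move: Bu0; rewrite mulBE.
have /freeP fW := basis_free (vbasisP W) => /fW u0'.
by apply/colP => j; rewrite u0' mxE.
Qed.

Lemma oproj_projector : projector (oproj W).
Proof.
rewrite oproj.unlock -/B; split.
  rewrite !adjmxM trmxCK mulmxA; congr (_ *m _ *m _).
  set G := B^t* *m B.
  have Gh : G^t* = G by rewrite /G adjmxM trmxCK.
  by rewrite trmx_inv map_invmx Gh.
by rewrite !mulmxA -(mulmxA _ (B^t*) B) mulmxKV.
Qed.

Lemma oprojP x : reflect (oproj W *m x = x) (x \in W).
Proof.
apply: (iffP idP) => [/memB[y ->]|<-]; rewrite oproj.unlock -/B -!mulmxA //.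
by rewrite (mulmxA (B^t*)) mulKmx.
Qed.

Lemma mxtrace_oproj : \tr (oproj W) = (\dim W)%:R.
Proof.
by rewrite oproj.unlock -/B -mulmxA mxtrace_mulC -mulmxA mulVmx // mxtrace1.
Qed.

Lemma oproj_uniq (P : 'M[C]_n) : projector P ->
  (forall x, x \in W <-> P *m x = x) -> oproj W = P.
Proof.
case=> Ph Pi PW; have [Oh Oi] := oproj_projector.
have mulcols (A M : 'M[C]_n) :
    (forall j, A *m col j M = col j M) -> A *m M = M.
  move=> AM; apply/matrixP => i j; have /colP/(_ i) := AM j.
  by rewrite colE mulmxA -!colE [LHS]mxE [RHS]mxE.
have PO : P *m oproj W = oproj W.
  by apply: mulcols => j; apply/PW/oprojP; rewrite colE mulmxA Oi.
have OP : oproj W *m P = P.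
  by apply: mulcols => j; apply/oprojP/PW; rewrite colE mulmxA Pi.
by rewrite -OP -[RHS]trmxCK adjmxM Oh Ph PO Oh.
Qed.

End OneSubspace.

(** The columns of a projector span its image, so preservation of a subspace is
    a matrix identity. *)
Lemma oproj_intertwine m n (W : {vspace 'cV[C]_m}) (W' : {vspace 'cV[C]_n})
    (A : 'M[C]_(n, m)) :
  (forall x, x \in W -> A *m x \in W') ->
  oproj W' *m (A *m oproj W) = A *m oproj W.
Proof.
move=> AW; have [_ Pi] := oproj_projector W; apply/matrixP => i j.
have /oprojP : A *m col j (oproj W) \in W'.
  by apply/AW/oprojP; rewrite colE mulmxA Pi.
rewrite colE (mulmxA A) (mulmxA (oproj W')) -!colE => /colP/(_ i).
by rewrite [LHS]mxE [RHS]mxE.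
Qed.

(** If the adjoint of [A] maps [W'] into [W], then [A] also maps the orthogonal
    complement of [W] into that of [W']. *)
Lemma oproj_commute m n (W : {vspace 'cV[C]_m}) (W' : {vspace 'cV[C]_n})
    (A : 'M[C]_(n, m)) :
  (forall x, x \in W -> A *m x \in W') ->
  (forall x, x \in W' -> A^t* *m x \in W) ->
  oproj W' *m A = A *m oproj W.
Proof.
move=> /oproj_intertwine AW /oproj_intertwine AW'.
have [Ph _] := oproj_projector W; have [Ph' _] := oproj_projector W'.
move: (oproj W) (oproj W') Ph Ph' AW AW' => P P' Ph Ph' <-.
by move=> /(congr1 (fun M => M^t*)); rewrite !adjmxM trmxCK Ph Ph' mulmxA => ->.
Qed.

End OrthogonalProjections.

(** * Eigenbases of hermitian matrices *)

Section RealPart.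
Variable R : realType.
Implicit Types z : R[i].

Lemma Re_le z w : z <= w -> complex.Re z <= complex.Re w.
Proof. by rewrite lecE => /andP[]. Qed.

Lemma Re_ge0 z : 0 <= z -> 0 <= complex.Re z.
Proof. exact: Re_le. Qed.

Lemma Re_eq0 z : 0 <= z -> complex.Re z = 0 -> z = 0.
Proof. by case: z => a b; rewrite lecE /= => /andP[/eqP-> _] ->. Qed.

Lemma ReD z w : complex.Re (z + w) = complex.Re z + complex.Re w.
Proof. by case: z; case: w. Qed.

Lemma ImD z w : complex.Im (z + w) = complex.Im z + complex.Im w.
Proof. by case: z; case: w. Qed.

Lemma ReN z : complex.Re (- z) = - complex.Re z.
Proof. by case: z. Qed.

Lemma ReB z w : complex.Re (z - w) = complex.Re z - complex.Re w.
Proof. by rewrite ReD ReN. Qed.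

Lemma Re_sum (J : Type) (r : seq J) (P : pred J) (F : J -> R[i]) :
  complex.Re (\sum_(i <- r | P i) F i) = \sum_(i <- r | P i) complex.Re (F i).
Proof. exact: (big_morph (@complex.Re R) ReD). Qed.

Lemma Re_mxtrace_sum n (J : Type) (r : seq J) (P : pred J)
    (F : J -> 'M[R[i]]_n) :
  complex.Re (\tr (\sum_(i <- r | P i) F i)) =
  \sum_(i <- r | P i) complex.Re (\tr (F i)).
Proof. by rewrite (big_morph (@mxtrace _ n) (raddfD _) (raddf0 _)) Re_sum. Qed.

Lemma ReZ (r : R) z : complex.Re (r%:C%C * z) = r * complex.Re z.
Proof. by case: z => a b /=; rewrite mul0r subr0. Qed.

Lemma ImZ (r : R) z : complex.Im (r%:C%C * z) = r * complex.Im z.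
Proof. by case: z => a b /=; rewrite mul0r addr0. Qed.

Lemma Re_conjc z : complex.Re z^* = complex.Re z.
Proof. by case: z. Qed.

Lemma conj_real (r : R) : (r%:C%C : R[i])^* = r%:C%C.
Proof. exact: conjc_real. Qed.

Lemma Re_nat n : complex.Re (n%:R : R[i]) = n%:R.
Proof. by rewrite -(rmorph_nat (real_complex R)). Qed.

End RealPart.

(** The squared length of the projection of [e]. Ranks and trace pairings are
    linear in the weights of an eigenbasis, which turns statements on subspaces
    into statements on families of numbers between 0 and 1. *)
Definition weight (R : realType) n (P : 'M[R[i]]_n) (e : 'cV[R[i]]_n) : R :=
  complex.Re (\tr (e^t* *m P *m e)).

Section Weight.
Variables (R : realType) (n : nat) (W : {vspace 'cV[R[i]]_n}).
Variable e : 'cV[R[i]]_n.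
Hypothesis e_unit : e^t* *m e = 1%:M.

Let pW := oproj_projector W.

Lemma weight_ge0 : 0 <= weight (oproj W) e.
Proof.
rewrite /weight; apply: Re_ge0.
by have := mxtrace_sandwich_ge0 (e^t*) pW; rewrite trmxCK.
Qed.

Lemma weight_le1 : weight (oproj W) e <= 1.
Proof.
rewrite /weight; have := Re_le (mxtrace_sandwich_le (e^t*) pW).
by rewrite trmxCK e_unit mxtrace1.
Qed.

Lemma weight_mem : e \in W -> weight (oproj W) e = 1.
Proof.
by move=> /oprojP eW; rewrite /weight -mulmxA eW e_unit mxtrace1.
Qed.

Lemma weight_eq0 : weight (oproj W) e = 0 -> e^t* *m oproj W = 0.
Proof.
rewrite /weight => w0; apply: (mxtrace_sandwich_eq0 pW); rewrite trmxCK.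
by apply: Re_eq0 w0; have := mxtrace_sandwich_ge0 (e^t*) pW; rewrite trmxCK.
Qed.

End Weight.

Definition eigenbasis (R : realType) n (h : 'M[R[i]]_n)
    (e : 'I_n -> 'cV[R[i]]_n) (d : 'I_n -> R) : Prop :=
  [/\ forall i j, (e i)^t* *m e j = (i == j)%:R%:M,
      \sum_i e i *m (e i)^t* = 1%:M
    & forall i, h *m e i = (d i)%:C%C *: e i].

Lemma hermitian_eigenbasis (R : realType) n (h : 'M[R[i]]_n) :
  h^t* = h -> exists e d, eigenbasis h e d.
Proof.
move=> hh; have hS : h \is hermsymmx.
  by apply/is_hermitianmxP; rewrite expr0 scale1r hh.
have /orthomx_spectralP := hermitian_normalmx hS.
have /mxOverP dR := hermitian_spectral_diag_real hS.
have Uu := spectral_unitarymx h; rewrite invmx_unitary // => hE.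
set U := spectralmx h in hE Uu; set D := spectral_diag h in hE dR.
have UU : U *m U^t* = 1%:M by apply/unitarymxP.
have UU' : U^t* *m U = 1%:M.
  by rewrite -(invmx_unitary Uu) mulVmx ?unitarymx_unit.
have delta_adj (i : 'I_n) :
    (delta_mx i 0 : 'cV[R[i]]_n)^t* = delta_mx 0 i :> 'rV_n.
  by rewrite trmx_delta map_delta_mx.
exists (fun i => U^t* *m delta_mx i 0), (fun i => complex.Re (D 0 i)).
split=> [i j||i].
- rewrite adjmxM trmxCK delta_adj mulmxA -(mulmxA _ U) UU mulmx1.
  rewrite mul_delta_mx_cond; apply/matrixP => a b.
  by rewrite !ord1 !mxE; case: eqP => _; rewrite ?mulr0n ?mulr1n ?mxE.
- under eq_bigr => i _.
    rewrite adjmxM trmxCK delta_adj mulmxA -(mulmxA (U^t*)) mul_delta_mx.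
    over.
  rewrite -mulmx_suml -mulmx_sumr.
  suff -> : \sum_(i < n) delta_mx i i = 1%:M :> 'M[R[i]]_n by rewrite mulmx1.
  by rewrite mx1_sum_delta.
rewrite [in LHS]hE -!mulmxA (mulmxA U) UU mul1mx scalemxAr; congr (_ *m _).
rewrite RRe_real ?dR // mul_diag_mx; apply/matrixP => a b; rewrite !mxE.
by case: eqP => [->|] //; rewrite ?mulr0.
Qed.

Section SpectralSubspaces.
Variables (R : realType) (n : nat) (h : 'M[R[i]]_n).
Variables (e : 'I_n -> 'cV[R[i]]_n) (d : 'I_n -> R).
Hypothesis eb : eigenbasis h e d.

Let e_orth i j : (e i)^t* *m e j = (i == j)%:R%:M. Proof. by case: eb. Qed.
Let e_full : \sum_i e i *m (e i)^t* = 1%:M. Proof. by case: eb. Qed.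
Let e_eigen i : h *m e i = (d i)%:C%C *: e i. Proof. by case: eb. Qed.

Lemma eigenbasis_unit i : (e i)^t* *m e i = 1%:M.
Proof. by rewrite e_orth eqxx. Qed.

Lemma Re_mxtrace_weight (P : 'M[R[i]]_n) :
  complex.Re (\tr P) = \sum_i weight P (e i).
Proof.
rewrite -{1}[P]mulmx1 -e_full mulmx_sumr Re_mxtrace_sum.
by apply: eq_bigr => i _; rewrite /weight mulmxA mxtrace_mulC mulmxA.
Qed.

Lemma Re_mxtrace_mul_weight (P : 'M[R[i]]_n) :
  complex.Re (\tr (P *m h)) = \sum_i weight P (e i) * d i.
Proof.
rewrite -[h]mulmx1 -e_full !mulmx_sumr Re_mxtrace_sum.
apply: eq_bigr => i _; rewrite !mulmxA -(mulmxA P) e_eigen -scalemxAr.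
by rewrite -scalemxAl linearZ /= ReZ mulrC mxtrace_mulC mulmxA.
Qed.

Lemma dim_weight (W : {vspace 'cV[R[i]]_n}) :
  (\dim W)%:R = \sum_i weight (oproj W) (e i).
Proof. by rewrite -Re_mxtrace_weight mxtrace_oproj Re_nat. Qed.

(** Selecting by eigenvalue, not by basis vector, makes these subspaces
    independent of the basis and stable under whatever commutes with [h]. *)
Definition spectral_subspace (T : pred R) : {vspace 'cV[R[i]]_n} :=
  (\sum_(i | T (d i)) <[e i]>)%VS.

Variable T : pred R.

Lemma spectral_subspace_mem i : T (d i) -> e i \in spectral_subspace T.
Proof.
by move=> Ti; apply: (subvP (sumv_sup i Ti (subvv _))); exact: memv_line.
Qed.

Lemma mem_spectral_subspace x :
  (forall i, ~~ T (d i) -> (e i)^t* *m x = 0) -> x \in spectral_subspace T.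
Proof.
move=> x0; rewrite -[x]mul1mx -e_full mulmx_suml; apply: memv_suml => i _.
have [Ti|/x0] := boolP (T (d i)); last first.
  by rewrite -mulmxA => ->; rewrite mulmx0 mem0v.
rewrite -mulmxA [_ *m x]mx11_scalar mul_mx_scalar memvZ //.
exact: spectral_subspace_mem.
Qed.

Lemma oproj_spectral_subspace :
  oproj (spectral_subspace T) = \sum_(i | T (d i)) e i *m (e i)^t*.
Proof.
have mulE j :
    (\sum_(i | T (d i)) e i *m (e i)^t*) *m e j = (T (d j))%:R *: e j.
  rewrite mulmx_suml; under eq_bigr do rewrite -mulmxA e_orth mul_mx_scalar.
  case: (boolP (T (d j))) => Tj.
    rewrite (bigD1 j) //= eqxx !scale1r big1 ?addr0 // => i /andP[_ ij].
    by rewrite (negPf ij) scale0r.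
  rewrite scale0r big1 // => i Ti; case: eqP => [ij|]; last by rewrite scale0r.
  by rewrite ij (negPf Tj) in Ti.
apply: oproj_uniq.
  split.
    rewrite raddf_sum [LHS]raddf_sum; apply: eq_bigr => i _ /=.
    by rewrite adjmxM trmxCK.
  rewrite mulmx_sumr; apply: eq_bigr => i Ti.
  by rewrite mulmxA mulE Ti scale1r.
move=> x; split=> [/memv_sumP[c cP ->]|<-].
  rewrite mulmx_sumr; apply: eq_bigr => i Ti.
  have /vlineP[k ->] := cP i Ti.
  by rewrite -scalemxAr mulE Ti scale1r.
rewrite mulmx_suml; apply: memv_suml => i Ti.
rewrite -mulmxA [_ *m x]mx11_scalar mul_mx_scalar memvZ //.
exact: spectral_subspace_mem.
Qed.

Lemma weight_spectral_subspace i :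
  weight (oproj (spectral_subspace T)) (e i) = (T (d i))%:R.
Proof.
have [Ti|Ti] := boolP (T (d i)).
  exact: weight_mem (eigenbasis_unit i) (spectral_subspace_mem Ti).
rewrite /weight oproj_spectral_subspace mulmx_sumr big1 ?mul0mx ?mxtrace0 //.
move=> j Tj; rewrite mulmxA e_orth; case: eqP => [ij|]; last first.
  by rewrite mul_scalar_mx scale0r.
by rewrite ij Tj in Ti.
Qed.

Lemma spectral_subspace_sub (W : {vspace 'cV[R[i]]_n}) :
  (forall i, ~~ T (d i) -> weight (oproj W) (e i) = 0) ->
  (W <= spectral_subspace T)%VS.
Proof.
move=> w0; apply/subvP => x /oprojP <-; apply: mem_spectral_subspace => i Ti.
by rewrite mulmxA weight_eq0 ?mul0mx // w0.
Qed.

End SpectralSubspaces.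

(** An intertwiner of two hermitian matrices maps each eigenspace into the
    eigenspace of the same eigenvalue. *)
Lemma spectral_subspace_intertwine (R : realType) m n
    (h : 'M[R[i]]_m) e d (k : 'M[R[i]]_n) f c (A : 'M[R[i]]_(n, m))
    (T : pred R) x :
  eigenbasis h e d -> eigenbasis k f c -> k^t* = k -> k *m A = A *m h ->
  x \in spectral_subspace e d T -> A *m x \in spectral_subspace f c T.
Proof.
move=> eb fb kk kA /memv_sumP[y yP ->]; rewrite mulmx_sumr.
apply: memv_suml => i Ti; have /vlineP[a ->] := yP i Ti.
rewrite -scalemxAr memvZ //; apply: (mem_spectral_subspace fb) => j Tj.
case: eb => _ _ /(_ i) hei; case: fb => _ _ /(_ j) kfj.
(* Evaluating [f_j^* k A e_i] on either side compares the two eigenvalues. *)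
have : (c j)%:C%C *: ((f j)^t* *m (A *m e i))
       = (d i)%:C%C *: ((f j)^t* *m (A *m e i)).
  rewrite [RHS]scalemxAr [X in _ = _ *m X]scalemxAr -hei (mulmxA A) -kA.
  rewrite scalemxAl -(mulmxA k) [RHS]mulmxA; congr (_ *m _).
  have := congr1 (fun M => M^t*) kfj.
  by rewrite adjmxM kk adjmxZ conj_real => ->.
move=> /eqP; rewrite -subr_eq0 -scalerBl scaler_eq0 subr_eq0.
case/orP => [/eqP/complexI cd|/eqP //].
by rewrite cd Ti in Tj.
Qed.

(** * The real moment map *)

Section GlCast.
Variables (R : realType) (I : finType) (v : I -> nat).

Lemma gl_cast_id l (M : 'M[R[i]]_(v l)) : gl_cast l M = M.
Proof. exact: conform_mx_id. Qed.

Lemma conform_mx0_linear (K : pzRingType) m n p q (c : K) (A B : 'M[K]_(m, n)) :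
  conform_mx (0 : 'M[K]_(p, q)) (c *: A + B)
  = c *: conform_mx 0 A + conform_mx 0 B.
Proof.
rewrite /conform_mx; case: eqP => [em|_]; last by rewrite scaler0 addr0.
case: eqP => [en|_]; last by rewrite scaler0 addr0.
by apply/matrixP => i j; rewrite !(castmxE, mxE).
Qed.

Lemma gl_castD k l (M N : 'M[R[i]]_(v k)) :
  gl_cast l (M + N) = gl_cast l M + gl_cast l N.
Proof. by rewrite /gl_cast -[M in LHS]scale1r conform_mx0_linear scale1r. Qed.

Lemma gl_cast0 k l : gl_cast l (0 : 'M[R[i]]_(v k)) = 0.
Proof.
(* For [c = -1] and [A = B = 0], linearity reads [x = - x + x]. *)
have := conform_mx0_linear (v l) (v l) (-1) (0 : 'M[R[i]]_(v k)) 0.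
by rewrite scaler0 addr0 scaleN1r addNr.
Qed.

Lemma gl_castZ k l c (M : 'M[R[i]]_(v k)) :
  gl_cast l (c *: M) = c *: gl_cast l M.
Proof.
have := gl_cast0 k l; rewrite /gl_cast => cast0.
by rewrite -[c *: M]addr0 conform_mx0_linear cast0 addr0.
Qed.

Lemma gl_cast_adj k l (M : 'M[R[i]]_(v k)) :
  k = l -> (gl_cast l M)^t* = gl_cast l (M^t*).
Proof. by case: l /; rewrite !gl_cast_id. Qed.

(** Summing over the vertices removes the casts: each arrow contributes at
    exactly one vertex. *)
Lemma sum_mxtrace_gl_cast (J : finType) (f : J -> I) (M : gl R v)
    (N : forall a : J, 'M[R[i]]_(v (f a))) :
  \sum_l \tr (M l *m \sum_(a | f a == l) gl_cast l (N a))
  = \sum_a \tr (M (f a) *m N a).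
Proof.
under eq_bigr do rewrite mulmx_sumr
  (big_morph (@mxtrace _ _) (raddfD _) (raddf0 _)).
rewrite (exchange_big_dep xpredT) //=; apply: eq_bigr => a _.
by rewrite (eq_bigl (pred1 (f a))) ?big_pred1_eq ?gl_cast_id // => l;
   rewrite eq_sym.
Qed.

End GlCast.

(** The sesquilinear map that polarizes [C |-> \sum_a [C_a, C_a^*]]. *)
HB.lock Definition bracket (R : realType) (I : finType) (Q : quiver I)
    (v : I -> nat) (C D : rep R Q v) : gl R v := fun l =>
  \sum_(a : arrow Q | qhead a == l) gl_cast l (C a *m (D a)^t*)
  - \sum_(a : arrow Q | qtail a == l) gl_cast l ((D a)^t* *m C a).

(** [-i] times the shifted real moment map: a hermitian endomorphism. At
    a critical point its eigenvalues are the slopes of the Harder-Narasimhan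
    filtration. *)
HB.lock Definition hmoment (R : realType) (I : finType) (Q : quiver I)
    (v : I -> nat) (alpha : I -> R[i]) (C : rep R Q v) : gl R v := fun l =>
  2%:R^-1 *: bracket C C l + ('i%C * alpha l)%:M.

Section RealMoment.
Variables (R : realType) (I : finType) (Q : quiver I) (v : I -> nat).
Implicit Types (C D X Y : rep R Q v) (alpha : I -> R[i]).

Lemma bracketE C l :
  bracket C C l
  = \sum_(a : arrow Q | qhead a == l) gl_cast l (C a *m (C a)^t*)
    - \sum_(a : arrow Q | qtail a == l) gl_cast l ((C a)^t* *m C a).
Proof. by rewrite bracket.unlock. Qed.

Lemma bracket_adj C D l : (bracket C D l)^t* = bracket D C l.
Proof.
rewrite bracket.unlock adjmxB; congr (_ - _);
  rewrite [X in map_mx _ X]raddf_sum [LHS]raddf_sum /=;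
  apply: eq_bigr => a /eqP al; rewrite gl_cast_adj // adjmxM trmxCK //.
Qed.

Lemma bracket_linel C X D (c : R[i]) l :
  bracket (fun a => C a + c *: X a) D l = bracket C D l + c *: bracket X D l.
Proof.
rewrite bracket.unlock scalerBr addrACA -opprD.
congr (_ - _); rewrite scaler_sumr -big_split; apply: eq_bigr => a _ /=.
  by rewrite mulmxDl -scalemxAl gl_castD gl_castZ.
by rewrite mulmxDr -scalemxAr gl_castD gl_castZ.
Qed.

Lemma bracket_liner C X D (c : R[i]) l :
  bracket C (fun a => D a + c *: X a) l = bracket C D l + c^* *: bracket C X l.
Proof.
by rewrite -!(bracket_adj _ C) bracket_linel adjmxD adjmxZ.
Qed.

Lemma bracket_line C X (t : R) l :
  bracket (rep_line C X t) (rep_line C X t) l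
  = bracket C C l + t%:C%C *: (bracket C X l + bracket X C l)
    + t%:C%C *: (t%:C%C *: bracket X X l).
Proof.
have lineL D : bracket (rep_line C X t) D l
    = bracket C D l + t%:C%C *: bracket X D l by exact: bracket_linel.
have lineR D : bracket D (rep_line C X t) l
    = bracket D C l + t%:C%C *: bracket D X l.
  by rewrite -[in RHS]conj_real; exact: bracket_liner.
move: (lineL (rep_line C X t)) (lineR C) (lineR X).
move: (rep_line C X t) => L -> -> ->.
by rewrite !scalerDr !addrA.
Qed.

Lemma sum_mxtrace_bracket (M : gl R v) C D :
  \sum_l \tr (M l *m bracket C D l)
  = \sum_(a : arrow Q) (\tr (M (qhead a) *m (C a *m (D a)^t*))
             - \tr (M (qtail a) *m ((D a)^t* *m C a))).
Proof.
rewrite bracket.unlock sumrB.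
rewrite -(sum_mxtrace_gl_cast M (fun a => C a *m (D a)^t*)).
rewrite -(sum_mxtrace_gl_cast M (fun a => (D a)^t* *m C a)) -sumrB.
by apply: eq_bigr => l _; rewrite mulmxBr [LHS]raddfB.
Qed.

Lemma real_moment_hmoment alpha C l :
  real_moment C l - (alpha l)%:M = 'i%C *: hmoment alpha C l.
Proof.
rewrite hmoment.unlock /real_moment -bracketE scalerDr scalerA scale_scalar_mx.
by rewrite mulrA -expr2 sqr_i mulN1r raddfN.
Qed.

Lemma moment_normsqE alpha C :
  moment_normsq alpha C
  = complex.Re (\sum_l \tr ((hmoment alpha C l)^t* *m hmoment alpha C l)).
Proof.
rewrite /moment_normsq /gl_normsq; congr (complex.Re _); apply: eq_bigr => l _.
rewrite real_moment_hmoment adjmxZ -scalemxAl -scalemxAr scalerA.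
have -> : ('i%C : R[i])^* * 'i%C = 1; last by rewrite scale1r.
apply/eqP; rewrite eq_complex /= !(mul0r, mul1r, mulr0, mulr1, mulN1r).
by rewrite opprK add0r addr0 !eqxx.
Qed.

Section Hermitian.
Variable alpha : I -> R[i].
Hypothesis alpha_imaginary : forall l, complex.Re (alpha l) = 0.

Lemma hmoment_adj C l : (hmoment alpha C l)^t* = hmoment alpha C l.
Proof.
rewrite hmoment.unlock adjmxD adjmxZ adjmx_scalar bracket_adj.
congr (_ *: _ + _%:M).
  by rewrite fmorphV rmorph_nat.
have := alpha_imaginary l; case: (alpha l) => a b /= ->.
apply/eqP; rewrite eq_complex /=.
by rewrite !(mul0r, mul1r, mulr0, subr0, addr0, oppr0) !eqxx.
Qed.

Lemma hmoment_line C X t l :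
  hmoment alpha (rep_line C X t) l
  = hmoment alpha C l
    + t%:C%C *: (2%:R^-1 *: (bracket C X l + bracket X C l))
    + t%:C%C *: (t%:C%C *: (2%:R^-1 *: bracket X X l)).
Proof.
rewrite hmoment.unlock bracket_line.
have swap (c d : R[i]) (M : 'M[R[i]]_(v l)) : c *: (d *: M) = d *: (c *: M).
  by rewrite !scalerA mulrC.
move: (bracket C C l) (bracket C X l + bracket X C l) (bracket X X l) => a b c.
rewrite 2!scalerDr (swap _ _ b) (swap _ _ (_ *: c)) (swap _ _ c).
move: (2%:R^-1 *: a) (t%:C%C *: (2%:R^-1 *: b)) => p q.
by move: (t%:C%C *: _) (_%:M) => r s; rewrite [LHS]addrAC [p + q + s]addrAC.
Qed.

End Hermitian.
End RealMoment.

(** * Critical points of the squared norm *)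

Section Criticality.

(** All functions to be differentiated are polynomial along lines, so a
    derivative at [0] is a coefficient. *)
Lemma is_derive0_poly (R : realType) (f : R -> R) (p : {poly R}) (d : R) :
  (forall t, f t = p.[t]) -> is_derive (0 : R) 1 f d <-> d = p`_1.
Proof.
move=> fp; have -> : f = horner p by apply/funext.
have dp := is_derive_poly p 0; rewrite horner_coef0 coef_deriv mulr1n in dp.
by split=> [/@derive_val <-|->]; [rewrite (@derive_val _ _ _ _ _ _ _ dp)|].
Qed.

Variables (R : realType) (I : finType) (v : I -> nat).

Definition gl_dot (X Y : gl R v) : R :=
  complex.Re (\sum_l \tr ((X l)^t* *m Y l)).

Lemma gl_dotC X Y : gl_dot X Y = gl_dot Y X.
Proof.
rewrite /gl_dot !Re_sum; apply: eq_bigr => l _.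
by rewrite -Re_conjc -mxtrace_adj adjmxM trmxCK.
Qed.

Lemma gl_dot_linear (X Y Z : gl R v) (t : R) :
  gl_dot X (fun l => Y l + t%:C%C *: Z l) = gl_dot X Y + t * gl_dot X Z.
Proof.
rewrite /gl_dot !Re_sum mulr_sumr -big_split /=; apply: eq_bigr => l _.
by rewrite mulmxDr -scalemxAr mxtraceD mxtraceZ ReD ReZ.
Qed.

Lemma gl_dot_quadratic (A B E : gl R v) : exists2 p : {poly R},
  p`_1 = 2 * gl_dot A B &
  forall t, let u l := A l + t%:C%C *: B l + t%:C%C *: (t%:C%C *: E l) in
    gl_dot u u = p.[t].
Proof.
pose a := gl_dot A A; pose b := gl_dot A B; pose c := gl_dot A E.
pose d := gl_dot B B; pose e := gl_dot B E; pose f := gl_dot E E.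
exists (Poly [:: a; 2 * b; 2 * c + d; 2 * e; f]); first by rewrite coef_Poly.
move=> t u.
have dotu X : gl_dot X u = gl_dot X A + t * gl_dot X B + t * (t * gl_dot X E).
  rewrite /u (gl_dot_linear X (fun l => A l + t%:C%C *: B l)
    (fun l => t%:C%C *: E l)) gl_dot_linear; congr (_ + _ * _).
  rewrite /gl_dot !Re_sum mulr_sumr; apply: eq_bigr => l _.
  by rewrite -scalemxAr mxtraceZ ReZ.
rewrite dotu !(gl_dotC u) !dotu horner_Poly /= -/a -/b -/c -/d -/e -/f.
rewrite !(gl_dotC B A) !(gl_dotC E A) !(gl_dotC E B) -/b -/c -/e.
by clearbody a b c d e f; rewrite mul0r add0r; ring.
Qed.

Variables (Q : quiver I) (alpha : I -> R[i]).
Hypothesis alpha_imaginary : forall l, complex.Re (alpha l) = 0.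

(** Along [X] the squared norm changes at the rate
    [2 \sum_a Re <h C_a - C_a h, X_a>]; the choice [X = h C - C h] turns
    criticality into the vanishing of a norm. *)
Lemma critical_hmoment_commute (C : rep R Q v) a :
  critical (moment_normsq alpha) C ->
  hmoment alpha C (qhead a) *m C a = C a *m hmoment alpha C (qtail a).
Proof.
set h := hmoment alpha C => crit.
have hh l : (h l)^t* = h l by exact: hmoment_adj.
pose X : rep R Q v := fun a => h (qhead a) *m C a - C a *m h (qtail a).
pose B : gl R v := fun l => 2%:R^-1 *: (bracket C X l + bracket X C l).
have [p p1 pE] := gl_dot_quadratic h B (fun l => 2%:R^-1 *: bracket X X l).
have p10 : 0 = p`_1.
  apply/(@is_derive0_poly _ (fun t => moment_normsq alpha (rep_line C X t))).
    move=> t; rewrite -pE moment_normsqE /gl_dot; congr (complex.Re _).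
    by apply: eq_bigr => l _; rewrite hmoment_line.
  exact: crit.
(* The two terms of [B] are adjoint, hence contribute equally. *)
have BX : gl_dot h B = complex.Re (\sum_l \tr (h l *m bracket C X l)).
  rewrite /gl_dot !Re_sum; apply: eq_bigr => l _.
  rewrite hh /B -scalemxAr mxtraceZ mulmxDr mxtraceD.
  rewrite -[bracket X C l]bracket_adj -{2}[h l]hh -adjmxM mxtrace_adj.
  rewrite (mxtrace_mulC (bracket C X l)).
  by rewrite (addcJ (\tr _)) mulKf ?pnatr_eq0.
have XE : \sum_a \tr (X a *m (X a)^t*) = \sum_l \tr (h l *m bracket C X l).
  rewrite sum_mxtrace_bracket; apply: eq_bigr => b _.
  rewrite {1}/X mulmxBl raddfB /= -!mulmxA; congr (_ - _).
  by rewrite mxtrace_mulC -mulmxA.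
have X0 : \sum_a \tr (X a *m (X a)^t*) = 0.
  apply: Re_eq0.
    by apply: sumr_ge0 => b _; exact: mxtrace_mul_adj_ge0.
  have /eqP : 2 * gl_dot h B = 0 by rewrite -p1 -p10.
  by rewrite mulf_eq0 pnatr_eq0 /= XE -BX => /eqP.
move/eqP: X0; rewrite psumr_eq0; last first.
  by move=> b _; exact: mxtrace_mul_adj_ge0.
move=> /allP/(_ a (mem_index_enum a))/= /eqP/mxtrace_mul_adj_eq0/eqP.
by rewrite subr_eq0 => /eqP.
Qed.

End Criticality.

(** * Degrees, ranks and slopes *)

Section Degree.
Variables (R : realType) (I : finType) (Q : quiver I) (v : I -> nat).
Variable alpha : I -> R[i].
Implicit Types (C D X Y : rep R Q v) (U W : subspaces R v) (w : I -> nat).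

Definition degree w : R := complex.Re (\sum_l 'i%C * alpha l * (w l)%:R).

Definition dims W : I -> nat := fun l => \dim (W l).

Definition rank W : R := (total_dim (dims W))%:R.

Lemma degreeE w : degree w = \sum_l complex.Re ('i%C * alpha l) * (w l)%:R.
Proof.
rewrite /degree Re_sum; apply: eq_bigr => l _.
by rewrite mulrC -(rmorph_nat (real_complex R)) ReZ mulrC.
Qed.

Section Quotient.
Variables U W : subspaces R v.
Hypothesis UW : subspaces_le U W.

Lemma quot_dim_rank : (total_dim (quot_dim U W))%:R = rank W - rank U.
Proof.
rewrite /rank /total_dim !natr_sum -sumrB; apply: eq_bigr => l _.
by rewrite natrB // dimvS.
Qed.

Lemma quot_dim_degree :
  degree (quot_dim U W) = degree (dims W) - degree (dims U).
Proof.
rewrite !degreeE -sumrB; apply: eq_bigr => l _.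
by rewrite -mulrBr natrB // dimvS.
Qed.

Lemma quot_dim_gt0 : (0 < total_dim (quot_dim U W))%N = (rank U < rank W).
Proof. by rewrite -(ltr0n R) quot_dim_rank subr_gt0. Qed.

Lemma slope_quot_le l : rank U < rank W ->
  (slope alpha (quot_dim U W) <= l)
  = (degree (dims W) - degree (dims U) <= l * (rank W - rank U)).
Proof.
move=> UWr; rewrite /slope -/(degree _) quot_dim_degree quot_dim_rank.
by rewrite ler_pdivrMr // subr_gt0.
Qed.

Lemma slope_quot_eq l : rank U < rank W ->
  slope alpha (quot_dim U W) = l <->
  degree (dims W) - degree (dims U) = l * (rank W - rank U).
Proof.
move=> UWr; rewrite /slope -/(degree _) quot_dim_degree quot_dim_rank.
have n0 : rank W - rank U != 0 by rewrite subr_eq0 gt_eqF.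
by split=> [<-|->]; [rewrite mulfVK|rewrite mulfK].
Qed.

End Quotient.

Lemma HN_step_intro D U W (l : R) :
  quot_subrep D U W ->
  degree (dims W) - degree (dims U) = l * (rank W - rank U) ->
  (forall W', quot_subrep D U W' ->
     degree (dims W') - degree (dims U) <= l * (rank W' - rank U) /\
     (degree (dims W') - degree (dims U) = l * (rank W' - rank U) ->
      rank W' <= rank W)) ->
  HN_step alpha D U W.
Proof.
move=> qW dW maxW; split=> // W' qW'; case: (qW) => _ UW.
rewrite quot_dim_gt0 // => UWr.
have sW : slope alpha (quot_dim U W) = l by apply/slope_quot_eq.
have [W'le W'rk] := maxW _ qW'; case: (qW') => _ UW'.
rewrite quot_dim_gt0 // => UWr'; rewrite sW slope_quot_le //; split=> // sW'.
rewrite -(ler_nat R) !quot_dim_rank // lerB //; apply: W'rk.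
exact/slope_quot_eq.
Qed.

Lemma sum_mxtrace_hmoment D (P : gl R v) :
  complex.Re (\sum_l \tr (P l *m hmoment alpha D l))
  = 2^-1 * complex.Re (\sum_(a : arrow Q)
        (\tr (P (qhead a) *m (D a *m (D a)^t*))
         - \tr (P (qtail a) *m ((D a)^t* *m D a))))
    + complex.Re (\sum_l 'i%C * alpha l * \tr (P l)).
Proof.
rewrite -sum_mxtrace_bracket -ReZ -ReD mulr_sumr -big_split /=.
congr (complex.Re _); apply: eq_bigr => l _; rewrite hmoment.unlock.
rewrite mulmxDr -scalemxAr mxtraceD mxtraceZ mul_mx_scalar mxtraceZ.
by rewrite fmorphV rmorph_nat.
Qed.

(** For a subrepresentation [W] with projector [P], the trace of
    [P [D_a, D_a^*]] is the squared norm of the component of [D_a] from the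
    orthogonal complement of [W] to [W]; it measures how far the complement is
    from being a subrepresentation as well. *)
Lemma degree_le D W : subrep D W ->
  degree (dims W)
  <= complex.Re (\sum_l \tr (oproj (W l) *m hmoment alpha D l)).
Proof.
move=> sW; rewrite sum_mxtrace_hmoment /degree.
under [X in _ <= _ + complex.Re X]eq_bigr do rewrite mxtrace_oproj.
rewrite lerDr mulr_ge0 ?invr_ge0 // Re_sum; apply: sumr_ge0 => a _.
set P := oproj (W (qhead a)); set P' := oproj (W (qtail a)).
have [Ph Pi] : projector P by exact: oproj_projector.
have pP' : projector P' by exact: oproj_projector.
have DP : P *m (D a *m P') = D a *m P'.
  by apply: oproj_intertwine => x; exact: sW.
rewrite ReB subr_ge0; apply: Re_le.
have -> : \tr (P' *m ((D a)^t* *m D a))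
    = \tr ((P *m D a) *m P' *m (P *m D a)^t*).
  rewrite -(mulmxA P) DP adjmxM Ph [RHS]mxtrace_mulC -[in RHS]mulmxA DP.
  by rewrite [LHS]mxtrace_mulC -mulmxA.
have -> : \tr (P *m (D a *m (D a)^t*)) = \tr ((P *m D a) *m (P *m D a)^t*).
  rewrite adjmxM Ph [RHS]mxtrace_mulC -[in RHS]mulmxA (mulmxA P P) Pi.
  by rewrite [X in \tr X = _]mulmxA [LHS]mxtrace_mulC.
exact: mxtrace_sandwich_le.
Qed.

(** When [P] commutes with [D], the commutator terms cancel. *)
Lemma degree_eq D W :
  (forall a, oproj (W (qhead a)) *m D a = D a *m oproj (W (qtail a))) ->
  degree (dims W)
  = complex.Re (\sum_l \tr (oproj (W l) *m hmoment alpha D l)).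
Proof.
move=> PD; rewrite sum_mxtrace_hmoment /degree.
under [X in _ = _ + complex.Re X]eq_bigr do rewrite mxtrace_oproj.
rewrite [X in _ = _ * complex.Re X + _]big1.
  by rewrite [complex.Re 0]/= mulr0 add0r.
move=> a _; rewrite mulmxA PD [X in X - _]mxtrace_mulC.
by rewrite [X in _ - X]mxtrace_mulC -mulmxA subrr.
Qed.

End Degree.

(** * The Harder-Narasimhan filtration near a critical point *)

Lemma fin_gap (R : realType) (J : finType) (g : J -> R) :
  exists2 delta, 0 < delta & forall j, 0 < g j -> delta <= g j.
Proof.
case: (pickP (fun j => 0 < g j)) => [j0 gj0|g0]; last first.
  by exists 1 => // j; rewrite g0.
have [j gj jmin] := @arg_minP _ _ _ j0 (fun j => 0 < g j) g gj0.
by exists (g j).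
Qed.

(** A projector has norm at most the square root of [n]; the inequality
    [2 Re <P, N> <= |P|^2 + |N|^2] then suffices in place of Cauchy-Schwarz. *)
Lemma oproj_trace_bound (R : realType) n (M : 'M[R[i]]_n) :
  exists K, forall W : {vspace 'cV[R[i]]_n},
    `|complex.Re (\tr (oproj W *m M))| <= K.
Proof.
have square (a y z m : R) : a <= m -> 0 <= a - z - (z - y) -> 2 * z <= m + y.
  by lra.
have key (m y z : R) : 2 * z <= m + y -> 2 * - z <= m + y ->
    `|z| <= 2^-1 * (m + y) by rewrite ler_norml; lra.
exists (2^-1 * (n%:R + complex.Re (\tr (M^t* *m M)))) => W.
have [Ph Pi] := oproj_projector W.
have trP : complex.Re (\tr (oproj W)) <= n%:R.
  rewrite mxtrace_oproj Re_nat ler_nat.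
  by rewrite (leq_trans (dimvS (subvf W))) // dimvf /dim /= muln1.
have half (N : 'M[R[i]]_n) : 2 * complex.Re (\tr (oproj W *m N))
    <= n%:R + complex.Re (\tr (N^t* *m N)).
  apply: square trP _.
  have := Re_ge0 (mxtrace_mul_adj_ge0 (oproj W - N^t*)).
  have trN : complex.Re (\tr (N^t* *m oproj W))
      = complex.Re (\tr (oproj W *m N)).
    by rewrite -Re_conjc -mxtrace_adj adjmxM trmxCK Ph.
  have trB (A B : 'M[R[i]]_n) : \tr (A - B) = \tr A - \tr B by exact: raddfB.
  by rewrite adjmxB trmxCK Ph mulmxBl !mulmxBr Pi !trB !ReB trN.
apply: key; first exact: half.
have := half (- M).
have trN (A : 'M[R[i]]_n) : \tr (- A) = - \tr A by exact: raddfN.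
have -> : (- M)^t* = - M^t* by rewrite linearN map_mxN.
by rewrite mulmxN mulNmx mulmxN opprK trN ReN.
Qed.

Section CriticalSpectrum.
Variables (R : realType) (I : finType) (Q : quiver I) (v : I -> nat).
Variables (alpha : I -> R[i]) (C : rep R Q v).
Hypothesis alpha_imaginary : forall l, complex.Re (alpha l) = 0.
Let h := hmoment alpha C.
Hypothesis hC : forall a, h (qhead a) *m C a = C a *m h (qtail a).
Variables (e : forall l, 'I_(v l) -> 'cV[R[i]]_(v l)).
Variables (d : forall l, 'I_(v l) -> R).
Hypothesis eb : forall l, eigenbasis (h l) (@e l) (@d l).

(* [K] indexes an orthonormal eigenbasis of the whole space, with eigenvalues
   [ev]; [wt W] are the weights of the subspaces [W] in this basis. *)
Let K : finType := {l : I & 'I_(v l)}.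
Let ev (k : K) : R := d (tagged k).
Let wt (W : subspaces R v) (k : K) : R :=
  weight (oproj (W (tag k))) (e (tagged k)).

Definition spectral_rep (T : pred R) : subspaces R v :=
  fun l => spectral_subspace (@e l) (@d l) T.

Implicit Types (T : pred R) (W : subspaces R v) (Y : rep R Q v).

Lemma wt_ge0 W k : 0 <= wt W k.
Proof. exact: weight_ge0. Qed.

Lemma wt_le1 W k : wt W k <= 1.
Proof. exact/weight_le1/(eigenbasis_unit (eb _)). Qed.

Lemma wt_spectral_rep T k : wt (spectral_rep T) k = (T (ev k))%:R.
Proof. exact: (weight_spectral_subspace (eb _)). Qed.

Lemma wt_above T W k :
  subspaces_le (spectral_rep T) W -> T (ev k) -> wt W k = 1.
Proof.
move=> TW Tk; apply: weight_mem; first exact: (eigenbasis_unit (eb _)).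
exact/(subvP (TW _))/spectral_subspace_mem.
Qed.

Lemma rank_wt W : rank W = \sum_k wt W k.
Proof.
rewrite /rank /total_dim natr_sum.
rewrite (eq_bigr _ (fun l _ => dim_weight (eb l) (W l))).
by rewrite (@sig_big_dep R _ _ I (fun l => 'I_(v l)) xpredT (fun=> xpredT)
  (fun l i => weight (oproj (W l)) (e i))).
Qed.

Lemma energy_wt W :
  complex.Re (\sum_l \tr (oproj (W l) *m h l)) = \sum_k wt W k * ev k.
Proof.
rewrite Re_sum.
rewrite (eq_bigr _ (fun l _ => Re_mxtrace_mul_weight (eb l) (oproj (W l)))).
by rewrite (@sig_big_dep R _ _ I (fun l => 'I_(v l)) xpredT (fun=> xpredT)
  (fun l i => weight (oproj (W l)) (e i) * d i)).
Qed.

Lemma h_adj l : (h l)^t* = h l.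
Proof. exact: hmoment_adj. Qed.

Lemma spectral_rep_subrep T : subrep C (spectral_rep T).
Proof.
by move=> a x; apply: (spectral_subspace_intertwine (eb _) (eb _) (h_adj _)).
Qed.

Lemma degree_spectral_rep T :
  degree alpha (dims (spectral_rep T)) = \sum_k (T (ev k))%:R * ev k.
Proof.
rewrite (@degree_eq _ _ _ _ _ C) => [|a].
  by rewrite energy_wt; apply: eq_bigr => k _; rewrite wt_spectral_rep.
apply: oproj_commute => x; first exact: spectral_rep_subrep.
apply: (spectral_subspace_intertwine (eb _) (eb _) (h_adj _)).
by rewrite -[in LHS]h_adj -[in RHS]h_adj -!adjmxM hC.
Qed.

Lemma rank_above T W : subspaces_le (spectral_rep T) W ->
  rank W - rank (spectral_rep T) = \sum_(k | ~~ T (ev k)) wt W k.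
Proof.
move=> TW; rewrite !rank_wt -sumrB [RHS]big_mkcond; apply: eq_bigr => k _.
rewrite wt_spectral_rep; case: ifPn => [/negPf->|/negPn Tk].
  by rewrite subr0.
by rewrite Tk (wt_above TW) // subrr.
Qed.

Lemma energy_above T W : subspaces_le (spectral_rep T) W ->
  \sum_k wt W k * ev k - degree alpha (dims (spectral_rep T))
  = \sum_(k | ~~ T (ev k)) wt W k * ev k.
Proof.
move=> TW; rewrite degree_spectral_rep -sumrB [RHS]big_mkcond.
apply: eq_bigr => k _; case: ifPn => [/negPf->|/negPn Tk].
  by rewrite mul0r subr0.
by rewrite Tk (wt_above TW) // subrr.
Qed.

Section Step.
Variables (T : pred R) (l : R).

(** Adding an eigenvalue [l] to the selected ones gives a quotient on which [h]
    is the scalar [l], hence of slope [l]. *)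
Definition add_value : pred R := fun x => T x || (x == l).

Lemma spectral_rep_add_value :
  subspaces_le (spectral_rep T) (spectral_rep add_value).
Proof.
move=> j; apply: (spectral_subspace_sub (eb j)) => i Ti.
rewrite (weight_spectral_subspace (eb j)).
by move: Ti; rewrite /add_value negb_or => /andP[/negPf->].
Qed.

Lemma rank_add_value : rank (spectral_rep add_value) - rank (spectral_rep T)
  = \sum_(k | ~~ T (ev k)) (ev k == l)%:R.
Proof.
rewrite rank_above; last exact: spectral_rep_add_value.
by apply: eq_bigr => k /negPf Tk; rewrite wt_spectral_rep /add_value Tk.
Qed.

Lemma degree_add_value :
  degree alpha (dims (spectral_rep add_value))
    - degree alpha (dims (spectral_rep T))
  = l * (rank (spectral_rep add_value) - rank (spectral_rep T)).
Proof.
rewrite rank_add_value mulr_sumr.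
have := energy_above spectral_rep_add_value.
rewrite (eq_bigr (fun k => (add_value (ev k))%:R * ev k)) => [|k _].
  rewrite -degree_spectral_rep => ->; apply: eq_bigr => k /negPf Tk.
  rewrite wt_spectral_rep /add_value Tk /=.
  by case: eqP => [->|]; rewrite ?mulr1 ?mul1r // mulr0 mul0r.
by rewrite wt_spectral_rep.
Qed.

Lemma rank_lt_add_value k : ~~ T (ev k) -> ev k = l ->
  rank (spectral_rep T) < rank (spectral_rep add_value).
Proof.
move=> Tk kl; rewrite -subr_gt0 rank_add_value (bigD1 k) //= kl eqxx.
by rewrite ltr_pwDl // sumr_ge0.
Qed.

End Step.

(** Modulo a spectral subrepresentation, a subrepresentation has slope at most
    a weighted average of the remaining eigenvalues, so the steepest and largest
    one is found by adding the eigenspace of the greatest of them. *)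
Lemma HN_step_spectral T W : HN_step alpha C (spectral_rep T) W ->
  exists l, [/\ W = spectral_rep (add_value T l),
    forall k, ~~ T (ev k) -> ev k <= l & exists2 k, ~~ T (ev k) & ev k = l].
Proof.
move=> [[sW TW]]; rewrite quot_dim_gt0 // => rTW Wmax.
have [k0 Tk0] : exists k, ~~ T (ev k).
  apply/existsP; apply: contraTT rTW => /existsPn Tall.
  rewrite -leNgt -subr_le0 rank_above // big_pred0 // => k.
  by apply/negbTE; exact: Tall.
have [k1 Tk1 k1max] := @arg_maxP _ _ _ k0 (fun k => ~~ T (ev k)) ev Tk0.
exists (ev k1); split; last by exists k1.
  2: by move=> k Tk; exact: k1max.
set l := ev k1; set W' := spectral_rep (add_value T l).
have TW' : subspaces_le (spectral_rep T) W' by exact: spectral_rep_add_value.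
have rTW' : rank (spectral_rep T) < rank W'.
  exact: (@rank_lt_add_value _ _ k1).
have qW' : quot_subrep C (spectral_rep T) W'.
  by split; [exact: spectral_rep_subrep| |rewrite quot_dim_gt0].
have [sle req] := Wmax _ qW'.
have slW' : slope alpha (quot_dim (spectral_rep T) W') = l.
  exact/slope_quot_eq/degree_add_value.
have slW : slope alpha (quot_dim (spectral_rep T) W) <= l.
  rewrite slope_quot_le // rank_above // mulr_sumr.
  apply: (@le_trans _ _ (\sum_(k | ~~ T (ev k)) wt W k * ev k)).
    by rewrite -energy_above // lerD2r -energy_wt; exact: degree_le.
  apply: ler_sum => k Tk; rewrite mulrC ler_wpM2r ?wt_ge0 //; exact: k1max.
have slWl : slope alpha (quot_dim (spectral_rep T) W) = l.
  by apply/eqP; rewrite eq_le slW -slW' sle.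
have WW' k : ~~ add_value T l (ev k) -> wt W k = 0.
  rewrite /add_value negb_or => /andP[Tk kl].
  (* Equality of the slopes forces [sum_j wt_j (l - ev_j) = 0], a sum of
     nonnegative terms. *)
  have gap_ge0 j : ~~ T (ev j) -> 0 <= wt W j * (l - ev j).
    by move=> Tj; rewrite mulr_ge0 ?wt_ge0 // subr_ge0; exact: k1max.
  have : \sum_(j | ~~ T (ev j)) wt W j * (l - ev j) <= 0.
    have /(slope_quot_eq alpha TW l rTW) := slWl.
    rewrite rank_above // mulr_sumr => dW.
    under eq_bigr do rewrite mulrBr mulrC.
    by rewrite sumrB -dW subr_le0 -energy_above // lerD2r -energy_wt degree_le.
  rewrite le_eqVlt ltNge sumr_ge0 // orbF psumr_eq0 // => /allP.
  move=> /(_ k (mem_index_enum k)); rewrite Tk mulf_eq0 subr_eq0 eq_sym.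
  by rewrite [l == _]eq_sym (negPf kl) orbF => /eqP.
have Wsub j : (W j <= W' j)%VS.
  apply: (spectral_subspace_sub (eb j)) => i Ti.
  exact: (WW' (Tagged (fun l => 'I_(v l)) i)).
have rWW' : rank W' <= rank W.
  have := req (etrans slW' (esym slWl)).
  by rewrite -(ler_nat R) !quot_dim_rank // lerD2r.
apply: functional_extensionality_dep => j; apply/eqP; rewrite eqEdim Wsub /=.
have : (\sum_i \dim (W' i) <= \sum_i \dim (W i))%N by rewrite -(ler_nat R).
rewrite leqNgt; apply: contraNT; rewrite -ltnNge => lt_j.
rewrite (bigD1 j) //= [X in (_ < X)%N](bigD1 j) //= -addSn leq_add //.
by apply: leq_sum => i _; exact: dimvS.
Qed.

Lemma HN_filtration_spectral L F j : HN_filtration alpha C L F -> (j <= L)%N ->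
  exists T, F j = spectral_rep T.
Proof.
move=> [F0 _ Fstep]; elim: j => [_|j IH jL].
  exists pred0; apply: functional_extensionality_dep => l; rewrite F0.
  by rewrite /spectral_rep /spectral_subspace big_pred0.
have [T FT] := IH (ltnW jL); have := Fstep j jL; rewrite FT.
by move=> /HN_step_spectral[l [-> _ _]]; exists (add_value T l).
Qed.

(** The bound [B] does not depend on [W]: the moment map at [C + t Y] is a
    polynomial in [t] with matrix coefficients, and the pairings of a fixed
    matrix with all projectors are bounded. *)
Lemma degree_line_le Y : exists2 B, 0 <= B & forall t W, `|t| <= 1 ->
  subrep (rep_line C Y t) W ->
  degree alpha (dims W) <= \sum_k wt W k * ev k + `|t| * B.
Proof.
pose M1 l := 2%:R^-1 *: (bracket C Y l + bracket Y C l).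
pose M2 l := 2%:R^-1 *: bracket Y Y l.
have [B1 B1P] := choice (fun l => oproj_trace_bound (M1 l)).
have [B2 B2P] := choice (fun l => oproj_trace_bound (M2 l)).
have B1_ge0 l : 0 <= B1 l by exact: le_trans (B1P l 0%VS).
have B2_ge0 l : 0 <= B2 l by exact: le_trans (B2P l 0%VS).
exists (\sum_l (B1 l + B2 l)) => [|t W t1 sW].
  by apply: sumr_ge0 => l _; rewrite addr_ge0.
apply: (le_trans (degree_le alpha sW)); rewrite -energy_wt !Re_sum.
rewrite mulr_sumr -big_split /=; apply: ler_sum => l _.
have -> : hmoment alpha (rep_line C Y t) l
    = h l + t%:C%C *: M1 l + t%:C%C *: (t%:C%C *: M2 l) by exact: hmoment_line.
have trE (P A A1 A2 : 'M[R[i]]_(v l)) :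
    complex.Re (\tr (P *m (A + t%:C%C *: A1 + t%:C%C *: (t%:C%C *: A2))))
    = complex.Re (\tr (P *m A)) + (t * complex.Re (\tr (P *m A1))
      + t * (t * complex.Re (\tr (P *m A2)))).
  by rewrite !mulmxDr -!scalemxAr !mxtraceD !mxtraceZ !ReD !ReZ -addrA.
rewrite trE lerD2l mulrDr.
have tB (z b : R) : `|z| <= b -> t * z <= `|t| * b.
  move=> zb; apply: (le_trans (ler_norm _)); rewrite normrM.
  by rewrite ler_wpM2l.
apply: lerD; first exact/tB/B1P.
apply: tB; rewrite normrM; apply: (le_trans _ (B2P l (W l))).
by rewrite ler_piMl.
Qed.

(** The estimate of [degree_line_le] is only approximate, but the degree and the
    rank of [W] depend on its dimension vector, of which there are finitely many
    values: once the error is below the least positive excess [d1] of a degree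
    over [l] times the rank, the slope inequality is exact. In the case of
    equality, the error is also below the gap [d2] between [l] and the lower
    eigenvalues, so that these contribute less than [1] to the rank. *)
Lemma HN_step_line T l Y :
  (forall k, ~~ T (ev k) -> ev k <= l) ->
  (exists2 k, ~~ T (ev k) & ev k = l) ->
  subrep Y (spectral_rep T) -> subrep Y (spectral_rep (add_value T l)) ->
  exists2 r, 0 < r & forall t, `|t| < r ->
    HN_step alpha (rep_line C Y t) (spectral_rep T)
      (spectral_rep (add_value T l)).
Proof.
set U := spectral_rep T; set U' := spectral_rep _ => evl [k1 Tk1 k1l] YU YU'.
have [B B_ge0 degB] := degree_line_le Y.
(* A finite index set that contains all dimension vectors of subspaces. *)
pose N := \max_l v l.
pose excess (w : {ffun I -> 'I_N.+1}) : R :=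
  degree alpha (fun l => w l) - degree alpha (dims U)
  - l * ((total_dim (fun l => w l))%:R - rank U).
have [d1 d1_gt0 d1P] := fin_gap excess.
have [d2 d2_gt0 d2P] := fin_gap (fun k => l - ev k).
pose r := Num.min 1 (Num.min d1 d2 / (B + 1)).
have B1_gt0 : 0 < B + 1 by rewrite ltr_wpDl.
exists r => [|t]; first by rewrite lt_min ltr01 divr_gt0 // lt_min d1_gt0.
rewrite lt_min ltr_pdivlMr // lt_min => /andP[t1 /andP[td1 td2]].
have tB : `|t| * B <= `|t| * (B + 1) by rewrite ler_wpM2l // lerDl.
have lineS W : subrep C W -> subrep Y W -> subrep (rep_line C Y t) W.
  move=> CW YW a x xW; rewrite /rep_line mulmxDl -scalemxAl.
  by rewrite memvD ?memvZ ?CW ?YW.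
have UU' : subspaces_le U U' by exact: spectral_rep_add_value.
apply: (@HN_step_intro _ _ _ _ _ _ _ _ l).
- split=> //; first by apply: lineS YU'; exact: spectral_rep_subrep.
  by rewrite quot_dim_gt0 //; exact: (@rank_lt_add_value _ _ k1).
- exact: degree_add_value.
move=> W [sW UW _].
have wP : exists w : {ffun I -> 'I_N.+1}, (fun l => w l : nat) = dims W.
  exists [ffun l => inord (dims W l)]; apply/funext => j.
  rewrite ffunE inordK // ltnS; apply: leq_trans (leq_bigmax j).
  by rewrite (leq_trans (dimvS (subvf (W j)))) // dimvf /dim /= muln1.
have {wP} [w wW] := wP.
have gap : degree alpha (dims W) - degree alpha (dims U)
    <= l * (rank W - rank U)
       - d2 * (\sum_(k | ~~ add_value T l (ev k)) wt W k) + `|t| * B.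
  have := degB t W (ltW t1) sW; rewrite -(lerD2r (- degree alpha (dims U))).
  move/le_trans; apply; rewrite addrAC lerD2r energy_above // rank_above //.
  have -> : \sum_(k | ~~ add_value T l (ev k)) wt W k
      = \sum_(k | ~~ T (ev k)) (if ev k == l then 0 else wt W k).
    rewrite big_mkcond [RHS]big_mkcond; apply: eq_bigr => k _.
    by rewrite /add_value; case: (T _); case: (_ == _).
  rewrite !mulr_sumr -sumrB; apply: ler_sum => k Tk.
  case: eqP => [->|/eqP kl]; first by rewrite mulr0 subr0 mulrC.
  rewrite -mulrBl mulrC ler_wpM2r ?wt_ge0 // lerBrDl -lerBrDr d2P //.
  by rewrite subr_gt0 lt_neqAle kl evl.
have wt_sum_ge0 : 0 <= \sum_(k | ~~ add_value T l (ev k)) wt W k.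
  by apply: sumr_ge0 => k _; exact: wt_ge0.
split=> [|degW].
  rewrite -subr_le0 leNgt; apply/negP => ex_gt0.
  have exE : excess w = degree alpha (dims W) - degree alpha (dims U)
      - l * (rank W - rank U) by rewrite /excess wW.
  have := d1P w; rewrite exE => /(_ ex_gt0); nra.
have small : \sum_(k | ~~ add_value T l (ev k)) wt W k < 1 by nra.
suff : rank W < rank U' + 1.
  by rewrite /rank natr1 ltr_nat ltnS ler_nat.
have -> : rank W = \sum_(k | add_value T l (ev k)) wt W k
    + \sum_(k | ~~ add_value T l (ev k)) wt W k.
  by rewrite rank_wt; exact: bigID.
have -> : rank U' = \sum_(k | add_value T l (ev k)) 1.
  rewrite rank_wt [RHS]big_mkcond; apply: eq_bigr => k _.
  by rewrite wt_spectral_rep; case: (add_value _ _ _).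
by apply: ler_ltD small; apply: ler_sum => k _; exact: wt_le1.
Qed.

End CriticalSpectrum.

(** * Tangent and normal vectors of the stratum *)

Lemma smooth_horner (R : realType) (p : {poly R}) : smooth (horner p).
Proof.
move=> n t; suff -> : derive1n n (horner p) = horner p^`(n).
  exact: derivable_horner.
elim: n => [|n IH]; first by rewrite derive1n0 derivn0.
by rewrite derive1nS IH -derivE derivnS.
Qed.

Lemma affine_horner (R : realType) (a b : R) :
  (fun t => a + t * b) = horner (Poly [:: a; b]).
Proof.
by apply/funext => t; rewrite horner_Poly /= mul0r add0r addrC mulrC.
Qed.

Lemma is_derive_affine (R : realType) (a b : R) :
  is_derive (0 : R) 1 (fun t => a + t * b) b.
Proof.
apply/(@is_derive0_poly _ _ (Poly [:: a; b])) => [t|].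
  by rewrite -affine_horner.
by rewrite coef_Poly.
Qed.

Section Stratum.
Variables (R : realType) (I : finType) (Q : quiver I) (v : I -> nat).
Variables (alpha : I -> R[i]) (C : rep R Q v).
Hypothesis alpha_imaginary : forall l, complex.Re (alpha l) = 0.
Hypothesis C_critical : critical (moment_normsq alpha) C.

(** Each step persists for small [t], and there are finitely many steps. *)
Lemma HN_filtration_line L F Y : HN_filtration alpha C L F ->
  (forall j, (j <= L)%N -> subrep Y (F j)) ->
  exists2 r, 0 < r & forall t, `|t| < r ->
    HN_filtration alpha (rep_line C Y t) L F.
Proof.
move=> HF YF.
have hC a := critical_hmoment_commute alpha_imaginary a C_critical.
have ex l := hermitian_eigenbasis (hmoment_adj alpha_imaginary C l).
pose e l := sval (cid (ex l)); pose d l := sval (cid (svalP (cid (ex l)))).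
have eb l : eigenbasis (hmoment alpha C l) (e l) (d l).
  exact: svalP (cid (svalP (cid (ex l)))).
have step (j : 'I_L) : exists r, 0 < r /\ forall t, `|t| < r ->
    HN_step alpha (rep_line C Y t) (F j) (F j.+1).
  have [T FT] :=
    HN_filtration_spectral alpha_imaginary hC eb HF (ltnW (ltn_ord j)).
  have [_ _ /(_ j (ltn_ord j))] := HF.
  have := YF j (ltnW (ltn_ord j)); have := YF j.+1 (ltn_ord j); rewrite FT.
  move=> YF' YFj /(HN_step_spectral alpha_imaginary hC eb)[l [FT' evl evk]].
  rewrite FT' in YF' *.
  have [r r0 rP] := HN_step_line alpha_imaginary hC eb evl evk YFj YF'.
  by exists r.
have [r rP] := choice step; have [r0 r0_gt0 r0P] := fin_gap r.
exists r0 => // t tr; case: HF => F0 FL _; split=> // j jL.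
have [rj_gt0 /(_ t)] := rP (Ordinal jL); apply.
exact: (lt_le_trans tr (r0P _ rj_gt0)).
Qed.

(** The line [C + t Y] itself stays in the stratum for small [t], with an
    unchanged filtration. *)
Lemma tangent_stratum vs F Y :
  HN_filtration alpha C (size vs) F ->
  (forall j l, (j < size vs)%N ->
     nth (fun=> 0%N) vs j l = quot_dim (F j) (F j.+1) l) ->
  (forall j, (j <= size vs)%N -> subrep Y (F j)) ->
  tangent (HN_stratum Q v alpha vs) C Y.
Proof.
move=> HF dF YF.
have ReE a i j : (fun t => complex.Re (rep_line C Y t a i j))
    = (fun t => complex.Re (C a i j) + t * complex.Re (Y a i j)).
  by apply/funext => t; rewrite !mxE ReD ReZ.
have ImE a i j : (fun t => complex.Im (rep_line C Y t a i j))
    = (fun t => complex.Im (C a i j) + t * complex.Im (Y a i j)).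
  by apply/funext => t; rewrite !mxE ImD ImZ.
exists (rep_line C Y); split.
- by move=> a i j; rewrite ReE ImE !affine_horner; split; exact: smooth_horner.
- by apply: functional_extensionality_dep => a; rewrite /rep_line scale0r addr0.
- have [r r0 rP] := HN_filtration_line HF YF.
  apply: filterS (@nbhs0_lt R R r r0) => t /rP HFt.
  by exists F.
- move=> a i j; split; first by rewrite ReE; exact: is_derive_affine.
  by rewrite ImE; exact: is_derive_affine.
Qed.

End Stratum.


Section Normal.
Variables (R : realType) (I : finType) (Q : quiver I) (v : I -> nat).

(** With [P] the projector onto [U], both [X (1 - P)] and [P X] preserve [U]:
    the first kills [U], the second takes values in it. The inner product of [X]
    with each of them is its squared norm, so both vanish. *)
Lemma orthogonal_to_preserving (U : subspaces R v) (X : rep R Q v) a :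
  (forall Y, subrep Y U -> rep_dot X Y = 0) ->
  X a *m oproj (U (qtail a)) = X a /\ oproj (U (qhead a)) *m X a = 0.
Proof.
move=> orth.
pose P l := oproj (U l); have pP l : projector (P l) by exact: oproj_projector.
have PU a' x : x \in U a' -> P a' *m x = x by move/oprojP.
have sum0 (Z : rep R Q v) :
    (forall a, \tr (X a *m (Z a)^t*) = \tr (Z a *m (Z a)^t*)) ->
    subrep Z U -> Z a = 0.
  move=> XZ ZU; apply: mxtrace_mul_adj_eq0.
  have Z_ge0 b : 0 <= \tr (Z b *m (Z b)^t*) by exact: mxtrace_mul_adj_ge0.
  have /eqP : \sum_b \tr (Z b *m (Z b)^t*) = 0.
    apply: Re_eq0; first by apply: sumr_ge0.
    by rewrite -[RHS](orth Z ZU) /rep_dot; congr (complex.Re _);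
       apply: eq_bigr => b _; rewrite XZ.
  rewrite psumr_eq0 // => /allP/(_ a (mem_index_enum a)) /= /eqP //.
split.
  apply/eqP; rewrite -subr_eq0 -opprB oppr_eq0 -{1}[X a]mulmx1 -mulmxBr.
  apply/eqP; apply: (sum0 (fun a => X a *m (1%:M - P (qtail a)))) => [b|b x xU].
    rewrite -mxtrace_sandwich; last exact: projectorC.
    have [Ph _] := projectorC (pP (qtail b)).
    by rewrite adjmxM Ph mulmxA.
  by rewrite -mulmxA mulmxBl mul1mx PU // subrr mulmx0 mem0v.
apply: (sum0 (fun a => P (qhead a) *m X a)) => [b|b x xU].
  have [Ph Pi] := pP (qhead b).
  by rewrite adjmxM Ph mulmxA [LHS]mxtrace_mulC -[in RHS]mulmxA
    [RHS]mxtrace_mulC -[in RHS]mulmxA -[in RHS]mulmxA Pi [LHS]mxtrace_mulC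
    mulmxA.
have [_ Pi] := pP (qhead b).
by apply/oprojP; rewrite -/(P _) !mulmxA Pi.
Qed.

End Normal.

(** * The holomorphic moment map *)

(** The bilinear map whose diagonal is the holomorphic moment map. *)
HB.lock Definition hol_polar (R : realType) (I : finType) (Q : quiver I)
    (v : I -> nat) (C D : rep R (double_quiver Q) v) : gl R v := fun l =>
  \sum_(a : arrow Q | qhead a == l) gl_cast l (partA C a *m partB D a)
  - \sum_(a : arrow Q | qtail a == l) gl_cast l (partB D a *m partA C a).

Section HolomorphicMoment.
Variables (R : realType) (I : finType) (Q : quiver I) (v : I -> nat).
Implicit Types (C D X : rep R (double_quiver Q) v).

Lemma hol_momentE C l : hol_moment C l = hol_polar C C l.
Proof. by rewrite hol_polar.unlock. Qed.

Lemma hol_polar_linel C X D (t : R) l :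
  hol_polar (rep_line C X t) D l = hol_polar C D l + t%:C%C *: hol_polar X D l.
Proof.
rewrite hol_polar.unlock scalerBr addrACA -opprD.
congr (_ - _); rewrite scaler_sumr -big_split; apply: eq_bigr => a _ /=.
  by rewrite /partA mulmxDl -scalemxAl gl_castD gl_castZ.
by rewrite /partA mulmxDr -scalemxAr gl_castD gl_castZ.
Qed.

Lemma hol_polar_liner C X D (t : R) l :
  hol_polar D (rep_line C X t) l = hol_polar D C l + t%:C%C *: hol_polar D X l.
Proof.
rewrite hol_polar.unlock scalerBr addrACA -opprD.
congr (_ - _); rewrite scaler_sumr -big_split; apply: eq_bigr => a _ /=.
  by rewrite /partB mulmxDr -scalemxAr gl_castD gl_castZ.
by rewrite /partB mulmxDl -scalemxAl gl_castD gl_castZ.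
Qed.

Lemma hol_moment_line C X (t : R) l :
  hol_moment (rep_line C X t) l
  = hol_moment C l + t%:C%C *: (hol_polar C X l + hol_polar X C l)
    + t%:C%C *: (t%:C%C *: hol_moment X l).
Proof.
rewrite !hol_momentE.
move: (hol_polar_linel C X (rep_line C X t) t l)
      (hol_polar_liner C X C t l) (hol_polar_liner C X X t l).
move: (rep_line C X t) => D -> -> ->.
by rewrite !scalerDr !addrA.
Qed.

(** The real and imaginary parts of each entry are quadratic polynomials in the
    line parameter; the kernel is read off their linear coefficients. *)
Lemma differential_kernelP C X :
  differential_kernel (@hol_moment R I Q v) C X <->
  forall l, hol_polar C X l + hol_polar X C l = 0.
Proof.
have part (f : R[i] -> R) : (forall z w, f (z + w) = f z + f w) ->
    (forall (r : R) z, f (r%:C%C * z) = r * f z) ->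
  forall l i j (b : R), is_derive (0 : R) 1
    (fun t => f (hol_moment (rep_line C X t) l i j)) b <->
    b = f ((hol_polar C X l + hol_polar X C l) i j).
  move=> fD fZ l i j b.
  set c1 := hol_polar C X l + hol_polar X C l.
  rewrite (@is_derive0_poly _ _ (Poly [:: f (hol_moment C l i j); f (c1 i j);
    f (hol_moment X l i j)])); first by rewrite coef_Poly.
  move=> t; rewrite hol_moment_line -/c1 horner_Poly /=.
  move: (hol_moment C l) c1 (hol_moment X l) => c0 c1 c2.
  rewrite !mxE !fD !fZ; ring.
have re := part _ (@ReD R) (@ReZ R); have im := part _ (@ImD R) (@ImZ R).
split=> [kerX l|ker0 l i j].
  apply/matrixP => i j; have [/re dre /im dim] := kerX l i j.
  rewrite [RHS]mxE; move: dre dim.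
  by case: ((hol_polar C X l + hol_polar X C l) i j) => a b /= <- <-.
by split; [apply/re|apply/im]; rewrite ker0 mxE.
Qed.

End HolomorphicMoment.

Section Nilpotent.
Variables (R : realType) (I : finType) (Q : quiver I) (v : I -> nat).

(** Such an [X] factors through [U] on the right and through its orthogonal
    complement on the left, so any product of two of its components is zero. *)
Lemma hol_moment_two_step (U : subspaces R v)
    (X : rep R (double_quiver Q) v) l :
  (forall a, X a *m oproj (U (qtail a)) = X a /\
             oproj (U (qhead a)) *m X a = 0) ->
  hol_moment X l = 0.
Proof.
move=> XU.
have mul0 m n p (A : 'M[R[i]]_(m, n)) P (B : 'M[R[i]]_(n, p)) :
  A *m P = A -> P *m B = 0 -> A *m B = 0.
  by move=> <-; rewrite -mulmxA => ->; rewrite mulmx0.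
have XA a : partA X a *m partB X a = 0.
  have [XP _] := XU (inl a); have [_ PX] := XU (inr a); exact: mul0 XP PX.
have XB a : partB X a *m partA X a = 0.
  have [XP _] := XU (inr a); have [_ PX] := XU (inl a); exact: mul0 XP PX.
by rewrite /hol_moment !big1 ?subr0 // => a _; rewrite ?XA ?XB gl_cast0.
Qed.

End Nilpotent.

Theorem theorem7p8 (R : realType) (I : finType) (Q : quiver I) (v : I -> nat)
    (alpha : I -> R[i])
    (alpha_imaginary : forall l, complex.Re (alpha l) = 0)
    (alpha_central : \sum_l alpha l * (v l)%:R = 0)
    (Q_two_filtered : two_filtered (double_quiver Q) v alpha)
    (vs : seq (I -> nat))
    (AB : rep R (double_quiver Q) v)
    (AB_critical : critical (moment_normsq alpha) AB)
    (AB_zero : hol_moment_zero Q v AB)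
    (AB_type : HN_stratum (double_quiver Q) v alpha vs AB) :
  exists2 e : R, 0 < e &
    hol_moment_zero Q v `&` normal_fibre (HN_stratum (double_quiver Q) v alpha vs) AB
      `&` rep_ball AB e
    = affine_kernel AB `&` normal_fibre (HN_stratum (double_quiver Q) v alpha vs) AB
      `&` rep_ball AB e.
Proof.
have [F [HF dF]] := AB_type; have L2 := Q_two_filtered _ _ _ HF.
have [F0 FL _] := HF.
(* The two sets already coincide before the intersection with a ball. *)
exists 1 => //; congr (_ `&` _).
suff eqv D : normal_fibre (HN_stratum (double_quiver Q) v alpha vs) AB D ->
    hol_moment_zero Q v D <-> affine_kernel AB D.
  by apply/seteqP; split=> D [D1 D2]; split=> //; apply/(eqv D).
move=> normD; set X := rep_sub D AB.
(* The end terms [0] and [V] of a filtration are preserved by everything, so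
   [F 1] is the only constraint; for length one it is [V], for length zero it
   is a junk value and [V = 0]. *)
have preserve (Y : rep R (double_quiver Q) v) : subrep Y (F 1%N) ->
    forall j, (j <= size vs)%N -> subrep Y (F j).
  move=> Y1 [|[|j]] jL; [|exact: Y1|] => a x.
    by rewrite !F0 memv0 => /eqP->; rewrite mulmx0 mem0v.
  have -> : j.+2 = size vs by apply/eqP; rewrite eqn_leq jL (leq_trans L2).
  by rewrite !FL !memvf.
have XU a : X a *m oproj (F 1%N (qtail a)) = X a /\
    oproj (F 1%N (qhead a)) *m X a = 0.
  apply: orthogonal_to_preserving => Y Y1; apply: normD.
  exact: (tangent_stratum alpha_imaginary AB_critical HF dF (preserve Y Y1)).
have DX : D = rep_line AB X 1.
  apply: functional_extensionality_dep => a.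
  by rewrite /rep_line /X /rep_sub scale1r addrC subrK.
have momD l : hol_moment D l = hol_polar AB X l + hol_polar X AB l.
  rewrite DX hol_moment_line (hol_moment_two_step l XU) !scaler0 addr0 scale1r.
  by rewrite AB_zero add0r.
rewrite /affine_kernel /= -/X differential_kernelP.
by split=> D0 l; [rewrite -momD D0|rewrite momD D0].
Qed.
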